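(* For a cache of size $M\ge 2n$, there exists an execution of the prototype dynamic programming algorithm $\mathcal{A}^*$ on an input of size $n$ (with recomputation of intermediate values allowed) that performs $\mathcal{O}(n/B)$ I/O operations, where each I/O operation moves up to $B$ memory words stored in consecutive locations between cache and slow memory.
   Context: Prototype algorithm $\mathcal{A}^*$: given an input of size $n$, set $S(i,i)$ to an initialization value for $i=1,\dots,n$; then for $\ell=2,\dots,n$ and $i=1,\dots,n-\ell+1$, with $j=i+\ell-1$, set $S(i,j)$ to a least-optimal value and for $k=i,\dots,j-1$ update $S(i,j)\leftarrow \mathrm{AGGREGATE}(S(i,j),\mathrm{COMBINE}(S(i,k),S(k+1,j)))$, where AGGREGATE is commutative and associative; the output is $S(1,n)$. Each value $S(i,j)$ and each intermediate result occupies one memory word, and COMBINE and AGGREGATE are unit-time operations. Memory model: a cache of $M$ words and an unbounded slow memory; an operation can be executed only when its operands are in cache; inputs are initially in slow memory; a read/write I/O operation moves up to $B$ consecutive words between slow memory and cache.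
   Formalization: The bound O(n/B) is stated as O(max(n/B, 1)) with one absolute constant, which is c·n/B whenever B ≤ n; for B much larger than n the literal bound fails since at least one I/O operation is always needed. Also n ≥ 1 and B ≥ 1 are assumed. *)

(* Defs.v *)
From mathcomp Require Import all_boot.

Set Implicit Arguments.
Unset Strict Implicit.
Unset Printing Implicit Defensive.

(* [init i w] is the initialization value of S(i,i) when [w] is the i-th input
   word. [least] is not assumed to be neutral for [aggregate]. *)
Record dp_ops (W : Type) := DpOps {
  init : nat -> W -> W;
  least : W;
  combine : W -> W -> W;
  aggregate : W -> W -> W;
  aggregateC : commutative aggregate;
  aggregateA : associative aggregate
}.

Section Algorithm.

Variables (W : Type) (P : dp_ops W) (n : nat).

Definition table := nat -> nat -> W.

Definition tset (T : table) (i j : nat) (v : W) : table :=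
  fun i' j' => if (i' == i) && (j' == j) then v else T i' j'.

(* The nested loops of the algorithm, run literally on a table S whose indices
   start at 1; [iota a l] enumerates a, ..., a + l - 1. *)
Definition loop_init (x : n.-tuple W) (T : table) : table :=
  foldl (fun T i => tset T i i (init P i (nth (least P) x i.-1))) T (iota 1 n).

Definition loop_k (i j : nat) (T : table) : table :=
  foldl (fun T k => tset T i j (aggregate P (T i j) (combine P (T i k) (T k.+1 j))))
        T (iota i (j - i)).

Definition loop_i (l : nat) (T : table) : table :=
  foldl (fun T i => let j := (i + l).-1 in loop_k i j (tset T i j (least P)))
        T (iota 1 (n - l).+1).

Definition loop_l (T : table) : table :=
  foldl (fun T l => loop_i l T) T (iota 2 n.-1).

Definition Astar (x : n.-tuple W) : W :=
  loop_l (loop_init x (fun _ _ => least P)) 1 n.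

End Algorithm.

(* The quantities of the algorithm that a memory word may hold:
   - [Input i]: the i-th input word;
   - [Partial i j K]: S(i,j) after it has been aggregated with the splits k
     listed in K (for i = j and K = [::], the initialized S(i,i));
   - [Combined i k j]: COMBINE(S(i,k), S(k+1,j)). *)
Inductive quantity :=
  | Input of nat
  | Partial of nat & nat & seq nat
  | Combined of nat & nat & nat.

(* [Partial i j K] is the final value S(i,j): every split i <= k < j has been
   aggregated exactly once, in any order. *)
Definition complete (i j : nat) (K : seq nat) : bool :=
  (i <= j) && perm_eq K (iota i (j - i)).

(* A memory word carries an actual value together with the quantity it stands
   for; the latter is bookkeeping which forces every computation step to be an
   operation of the algorithm on the right operands. *)
Record word (W : Type) := Word { qty : quantity; val_of : W }.

(* [None] is a location with no meaningful content. *)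
Record state (W : Type) (M : nat) := State {
  cache : 'I_M -> option (word W);
  slow : nat -> option (word W)
}.

Section Machine.

Variables (W : Type) (P : dp_ops W) (n M B : nat).

Implicit Types (s : state W M) (d a b : 'I_M).

Definition cache_set s d (w : word W) : state W M :=
  State (fun e => if e == d then Some w else cache s e) (slow s).

Definition block_read s (src dst len : nat) : state W M :=
  State (fun e : 'I_M => if dst <= e < dst + len then slow s (src + (e - dst))
                         else cache s e)
        (slow s).

Definition block_write s (src dst len : nat) : state W M :=
  State (cache s)
        (fun e => if dst <= e < dst + len
                  then obind (cache s) (insub (src + (e - dst)))
                  else slow s e).

(* [step io s s']: one operation leads from s to s'; [io] tells whether it is an
   I/O operation. The result of a computation goes to any cache location, and
   overwrites what was there (possibly an operand). A quantity may be computed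
   again at any time. *)
Inductive step : bool -> state W M -> state W M -> Prop :=
  | StepRead s src dst len :
      len <= B -> dst + len <= M ->
      step true s (block_read s src dst len)
  | StepWrite s src dst len :
      len <= B -> src + len <= M ->
      step true s (block_write s src dst len)
  | StepInit s a d i v :
      cache s a = Some (Word (Input i) v) ->
      step false s (cache_set s d (Word (Partial i i [::]) (init P i v)))
  | StepLeast s d i j :
      1 <= i < j -> j <= n ->
      step false s (cache_set s d (Word (Partial i j [::]) (least P)))
  | StepCombine s a b d i k j K1 K2 u v :
      cache s a = Some (Word (Partial i k K1) u) -> complete i k K1 ->
      cache s b = Some (Word (Partial k.+1 j K2) v) -> complete k.+1 j K2 ->
      step false s (cache_set s d (Word (Combined i k j) (combine P u v)))
  | StepAggregate s a b d i k j K u v :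
      cache s a = Some (Word (Partial i j K) u) ->
      cache s b = Some (Word (Combined i k j) v) -> k \notin K ->
      step false s (cache_set s d (Word (Partial i j (k :: K)) (aggregate P u v))).

(* [execution q s s']: a sequence of operations, q of which are I/Os. *)
Inductive execution : nat -> state W M -> state W M -> Prop :=
  | ExecNil s : execution 0 s s
  | ExecCons io q s1 s2 s3 :
      step io s1 s2 -> execution q s2 s3 -> execution (io + q) s1 s3.

(* Empty cache; the n input words are in slow locations 0, ..., n - 1. *)
Definition initial_state (x : n.-tuple W) : state W M :=
  State (fun=> None) (fun e => omap (Word (Input e.+1)) (onth x e)).

Definition has_output (x : n.-tuple W) s : Prop :=
  exists (e : nat) (K : seq nat),
    complete 1 n K /\ slow s e = Some (Word (Partial 1 n K) (Astar P x)).

Definition Astar_execution (x : n.-tuple W) (q : nat) : Prop :=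
  exists2 s, execution q (initial_state x) s & has_output x s.

End Machine.

(* Main.v *)
(** Read the n input words into cache cells 0, ..., n - 1 and turn them in place
    into the S(i,i). The other n cells suffice to evaluate the recurrence top
    down, recomputing every subproblem: an interval of length L >= 2 needs only L
    working cells. One cell holds the accumulator. For a split into lengths a and
    c with a + c = L, the left part needs a <= L - 1 cells and is then kept in one
    cell while the right part is computed, for a total of 1 + c <= L - 1 cells if
    a >= 2; if a = 1 the left part is a resident S(i,i) and costs nothing. Hence
    the only I/O operations are the reads of the input and one final write. *)
Require Import Defs.
From mathcomp Require Import all_boot zify.

Set Implicit Arguments.
Unset Strict Implicit.
Unset Printing Implicit Defensive.

Lemma iota_rcons i m : iota i m.+1 = rcons (iota i m) (i + m).
Proof. by rewrite -addn1 iotaD cats1. Qed.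

(** * The table left by the loops satisfies the interval recurrence *)

Section Recurrence.

Variables (W : Type) (P : dp_ops W) (n : nat).

(** The count [m] is independent of [j] so that an unfinished accumulator can be named, both in the
    loops and in the cache. *)
Definition splits_value (T : table W) (i j m : nat) : W :=
  foldl (fun acc k => aggregate P acc (combine P (T i k) (T k.+1 j)))
        (least P) (iota i m).

Lemma splits_valueS T i j m :
  splits_value T i j m.+1 =
  aggregate P (splits_value T i j m)
              (combine P (T i (i + m)) (T (i + m).+1 j)).
Proof. by rewrite /splits_value iota_rcons foldl_rcons. Qed.

Lemma eq_splits_value T T' i j m :
  (forall k, i <= k < i + m -> T i k = T' i k /\ T k.+1 j = T' k.+1 j) ->
  splits_value T i j m = splits_value T' i j m.
Proof.
elim: m => [//|m IHm] eqT; rewrite !splits_valueS IHm => [|k km].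
  by have [] := eqT (i + m); [lia | move=> -> ->].
by apply: eqT; lia.
Qed.

Lemma tset_eq (T : table W) i j v : tset T i j v i j = v.
Proof. by rewrite /tset !eqxx. Qed.

Lemma tset_neq (T : table W) i j v i' j' :
  (i' != i) || (j' != j) -> tset T i j v i' j' = T i' j'.
Proof. by rewrite /tset; case: (i' == i); case: (j' == j). Qed.

(** The operands [(i, k)] and [(k.+1, j)] differ from the written cell [(i, j)], so they keep their
    values from [T]. *)
Lemma loop_kP (T : table W) i j :
  let T0 := tset T i j (least P) in
  loop_k P i j T0 i j = splits_value T i j (j - i) /\
  forall i' j', (i' != i) || (j' != j) -> loop_k P i j T0 i' j' = T i' j'.
Proof.
rewrite /loop_k.
have: j - i <= j - i by [].
(* The bound [j - i] stays fixed while the number of processed splits varies, which keeps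
   [k < j]. *)
elim: {1 3 4 5}(j - i) => [|m IHm] lt_m.
  by split; [rewrite /= tset_eq | move=> i' j'; exact: tset_neq].
have [IHe IHn] := IHm (ltnW lt_m).
rewrite iota_rcons foldl_rcons.
split; last by move=> i' j' neq; rewrite tset_neq // IHn.
rewrite tset_eq splits_valueS IHe !IHn //; lia.
Qed.

(** A pass writes only intervals of length [l] and reads only shorter ones, so the new values are
    expressed through the old [T]. *)
Lemma loop_iP l (T : table W) : 1 < l ->
  (forall i, 0 < i -> i + l <= n.+1 ->
     loop_i P n l T i (i + l).-1 = splits_value T i (i + l).-1 l.-1) /\
  (forall i j, j.+1 != i + l -> loop_i P n l T i j = T i j).
Proof.
move=> l_gt1; rewrite /loop_i.
set T' := foldl _ _.
suff H m : (forall i, 0 < i <= m ->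
      T' (iota 1 m) i (i + l).-1 = splits_value T i (i + l).-1 l.-1) /\
    (forall i j, (m < i) || (j.+1 != i + l) -> T' (iota 1 m) i j = T i j).
  have [H1 H2] := H (n - l).+1; split=> [i i_gt0 le_i|i j neq].
    by apply: H1; lia.
  by apply: H2; rewrite neq orbT.
elim: m => [|m [IHe IHn]]; first by split=> // i; lia.
rewrite /T' iota_rcons foldl_rcons -/T' add1n.
have [kE kN] := loop_kP (T' (iota 1 m)) m.+1 (m.+1 + l).-1.
split=> [i le_i|i j neq].
  have [-> | neq_i] := eqVneq i m.+1.
    rewrite kE; have -> : (m.+1 + l).-1 - m.+1 = l.-1 by lia.
    by apply: eq_splits_value => k le_k; rewrite !IHn //; lia.
  by rewrite kN ?neq_i // IHe //; lia.
by rewrite kN ?IHn //; lia.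
Qed.

Variable x : n.-tuple W.

Definition final_table : table W :=
  loop_l P n (loop_init P x (fun _ _ => least P)).

Lemma loop_initP (T : table W) i : 0 < i <= n ->
  loop_init P x T i i = init P i (nth (least P) x i.-1).
Proof.
rewrite /loop_init; elim: {1 3}n => [|m IHm] le_i; first lia.
rewrite iota_rcons foldl_rcons add1n.
have [-> | neq_i] := eqVneq i m.+1; first by rewrite tset_eq.
by rewrite tset_neq ?neq_i // IHm //; lia.
Qed.

Lemma final_tableP :
  (forall i, 0 < i <= n ->
     final_table i i = init P i (nth (least P) x i.-1)) /\
  (forall i j, 0 < i < j -> j <= n ->
     final_table i j = splits_value final_table i j (j - i)).
Proof.
rewrite /final_table /loop_l.
set T0 := loop_init _ _ _; set F := foldl _ _.
(* After [m] passes the lengths up to [m.+1] are settled, that is [j - i <= m]; a later pass changes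
   neither side of their equations. *)
suff H m : m <= n.-1 ->
    (forall i, 0 < i <= n ->
       F (iota 2 m) i i = init P i (nth (least P) x i.-1)) /\
    (forall i j, 0 < i < j -> j <= n -> j - i <= m ->
       F (iota 2 m) i j = splits_value (F (iota 2 m)) i j (j - i)).
  have [H1 H2] := H _ (leqnn _); split=> // i j lt_ij le_j.
  by apply: H2; lia.
elim: m => [|m IHm] le_m.
  by split=> [i|i j]; [exact: loop_initP | lia].
have [IHd IHr] := IHm (ltnW le_m).
rewrite /F iota_rcons foldl_rcons -/F add2n.
have [iE iN] := @loop_iP m.+2 (F (iota 2 m)) isT.
split=> [i le_i|i j lt_ij le_j le_d]; first by rewrite iN ?IHd //; lia.
have [eq_d | neq_d] := eqVneq (j - i) m.+1.
  have -> : j = (i + m.+2).-1 by lia.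
  rewrite iE; [|lia|lia].
  have -> : (i + m.+2).-1 - i = m.+1 by lia.
  by apply: eq_splits_value => k le_k; rewrite !iN //; lia.
rewrite iN ?IHr; [|lia..].
by apply: eq_splits_value => k le_k; rewrite !iN //; lia.
Qed.

End Recurrence.

(** * Machine runs, with cache cells addressed by numbers *)

Section Execution.

Variables (W : Type) (P : dp_ops W) (n M B : nat).

Notation exec := (@execution W P n M B).

Definition cache_at (s : state W M) (e : nat) : option (word W) :=
  obind (cache s) (insub e).

Lemma cache_at_ord (s : state W M) (d : 'I_M) : cache_at s d = cache s d.
Proof. by rewrite /cache_at valK. Qed.

Lemma cache_at_set (s : state W M) (d : 'I_M) w e :
  cache_at (cache_set s d w) e = if e == d then Some w else cache_at s e.
Proof.
rewrite /cache_at; case: insubP => [u _ <- //|] /=.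
by case: eqP => // ->; rewrite ltn_ord.
Qed.

Lemma cache_at_read (s : state W M) src dst len e :
  dst + len <= M ->
  cache_at (block_read s src dst len) e =
  if dst <= e < dst + len then slow s (src + (e - dst)) else cache_at s e.
Proof.
move=> le_M; rewrite /cache_at; case: insubP => [u _ <- //|] /=.
by move=> ge_e; case: ifP => //; lia.
Qed.

Lemma cache_at_Some (s : state W M) e w :
  cache_at s e = Some w -> exists2 d : 'I_M, d = e :> nat & cache s d = Some w.
Proof. by rewrite /cache_at; case: insubP => //= d _ <- <-; exists d. Qed.

Lemma execution_trans q1 q2 s1 s2 s3 :
  exec q1 s1 s2 -> exec q2 s2 s3 -> exec (q1 + q2) s1 s3.
Proof.
by elim=> // io q s s' s'' st _ IH /IH e; rewrite -addnA; apply: ExecCons st e.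
Qed.

Lemma execution_step io s s' : step P n B io s s' -> exec io s s'.
Proof.
by move=> st; rewrite -[nat_of_bool io]addn0; apply: ExecCons st (ExecNil _ _ _ _).
Qed.

Lemma execution_rcons q io s1 s2 s3 :
  exec q s1 s2 -> step P n B io s2 s3 -> exec (q + io) s1 s3.
Proof. by move=> e /execution_step; apply: execution_trans. Qed.

(** * Evaluating an interval inside the cache without I/O *)

Section Compute.

Variable T : table W.
Hypothesis T_rec : forall i j, 0 < i < j -> j <= n ->
  T i j = splits_value P T i j (j - i).

Definition diagonal_in_cache (s : state W M) : Prop :=
  forall e, e < n -> cache_at s e = Some (Word (Partial e.+1 e.+1 [::]) (T e.+1 e.+1)).

Definition holds_final (s : state W M) (p i j : nat) : Prop :=
  exists2 K, complete i j K & cache_at s p = Some (Word (Partial i j K) (T i j)).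

Definition workspace (i j : nat) : nat := if i == j then 0 else (j - i).+1.

(** Cells below [b] hold the diagonal and the pending values of the callers, hence the frame
    condition. The bound on [p] lets a caller protect the result by raising its base by [i < j]: a
    resident diagonal value costs no cell. *)
Lemma compute_final d i j b s : j - i <= d ->
  0 < i <= j -> j <= n -> n <= b -> b + workspace i j <= M ->
  diagonal_in_cache s ->
  exists s' p, [/\ exec 0 s s', p < b + (i < j), holds_final s' p i j
    & forall e, (e < b) || (b + workspace i j <= e) ->
        cache_at s' e = cache_at s e].
Proof.
elim: d i j b s => [|d IHd] i j b s le_d le_ij le_jn le_nb le_M diag.
  have eq_ij : i = j by lia.
  subst j; exists s, i.-1; split=> //; [exact: ExecNil | lia |].
  exists [::]; first by rewrite /complete subnn leqnn.
  by rewrite diag ?prednK //; lia.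
have [eq_ij | neq_ij] := eqVneq i j.
  by apply: (IHd i j b s) => //; lia.
have lt_ij : 0 < i < j by lia.
move: le_M; rewrite {1}/workspace (negPf neq_ij) => le_M.
have wsE : workspace i j = (j - i).+1 by rewrite /workspace (negPf neq_ij).
have b_lt : b < M by lia.
have b1_lt : b.+1 < M by lia.
(* Cell [b] is the accumulator; the split list is reversed because each aggregation puts its split
   in front. *)
suff H m : m <= j - i -> exists s', [/\ exec 0 s s',
    cache_at s' b = Some (Word (Partial i j (rev (iota i m))) (splits_value P T i j m))
    & forall e, (e < b) || (b + workspace i j <= e) -> cache_at s' e = cache_at s e].
  have [s' [ex at_b same]] := H _ (leqnn _).
  exists s', b; split=> //; first lia.
  exists (rev (iota i (j - i))); last by rewrite T_rec.
  by rewrite /complete perm_rev perm_refl andbT; lia.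
elim: m => [|m IHm] le_m.
  have st := @StepLeast W P n M B s (Ordinal b_lt) i j lt_ij le_jn.
  eexists; split; first exact: execution_step st.
    by rewrite cache_at_set eqxx.
  by move=> e e_out; rewrite cache_at_set /=; case: eqP => //; lia.
have [s1 [ex1 at_b1 same1]] := IHm (ltnW le_m).
have diag1 : diagonal_in_cache s1.
  by move=> e lt_e; rewrite same1 ?diag //; lia.
set k := i + m.
have ws1 : b.+1 + workspace i k <= b + workspace i j.
  by rewrite wsE /workspace /k; case: eqP; lia.
(* With a right part of length at least 2, this is an equality for [m = 0] and [m = 1]. *)
have ws2 : b.+1 + (i < k) + workspace k.+1 j <= b + workspace i j.
  by rewrite wsE /workspace /k; case: eqP; lia.
have [|||||s2 [p2 [ex2 lt_p2 fin2 same2]]] :=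
  IHd i k b.+1 s1 _ _ _ _ _ diag1; [lia..|].
have diag2 : diagonal_in_cache s2.
  by move=> e lt_e; rewrite same2 ?diag1 //; lia.
have [|||||s3 [p3 [ex3 lt_p3 fin3 same3]]] :=
  IHd k.+1 j (b.+1 + (i < k)) s2 _ _ _ _ _ diag2; [lia..|].
have [K2 cK2 at_p2] := fin2.
have [K3 cK3 at_p3] := fin3.
(* The left value lies below the base of the second call, so it survives that call. *)
rewrite -same3 in at_p2; last by rewrite lt_p2.
have at_b3 : cache_at s3 b = cache_at s1 b by rewrite same3 ?same2 //; lia.
have [a2 _ c2] := cache_at_Some at_p2.
have [a3 _ c3] := cache_at_Some at_p3.
(* Cell [b.+1] may hold one of the operands, which can be overwritten from here on. *)
have st4 := @StepCombine W P n M B s3 a2 a3 (Ordinal b1_lt) _ _ _ _ _ _ _ c2 cK2 c3 cK3.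
set s4 := cache_set _ _ _ in st4.
have c4b : cache s4 (Ordinal b_lt) =
    Some (Word (Partial i j (rev (iota i m))) (splits_value P T i j m)).
  by rewrite -cache_at_ord cache_at_set /= ltn_eqF ?ltnSn // at_b3.
have c4c : cache s4 (Ordinal b1_lt) =
    Some (Word (Combined i k j) (combine P (T i k) (T k.+1 j))).
  by rewrite -cache_at_ord cache_at_set /= eqxx.
have kK : k \notin rev (iota i m) by rewrite mem_rev mem_iota /k; lia.
have st5 := @StepAggregate W P n M B s4 _ _ (Ordinal b_lt) _ _ _ _ _ _ c4b c4c kK.
eexists; split.
- have ex14 := execution_trans (execution_trans ex1 ex2) ex3.
  exact: (execution_rcons (execution_rcons ex14 st4) st5).
- rewrite cache_at_set eqxx splits_valueS; congr (Some (Word (Partial _ _ _) _)).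
  by rewrite iota_rcons rev_rcons.
- move=> e e_out; rewrite !cache_at_set /=.
  case: eqP => [|_]; first by lia.
  case: eqP => [|_]; first by lia.
  by rewrite same3 ?same2 ?same1 //; lia.
Qed.

End Compute.

(** * Loading the input, and the complete run *)

Variable x : n.-tuple W.

Lemma slow_initial e : e < n ->
  slow (initial_state M x) e = Some (Word (Input e.+1) (nth (least P) x e)).
Proof. by move=> lt_e; rewrite /= onthE (nth_map (least P)) ?size_tuple. Qed.

Lemma read_input m : n <= M -> exists s, [/\ exec m (initial_state M x) s,
  slow s = slow (initial_state M x)
  & forall e, e < n -> e < m * B -> cache_at s e = slow s e].
Proof.
move=> le_nM; elim: m => [|m [s [ex slowE readE]]].
  by exists (initial_state M x); split=> //; exact: ExecNil.
have len_B : minn B (n - m * B) <= B by exact: geq_minl.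
have [le_n | lt_n] := leqP n (m * B).
  (* Once the input is exhausted, an empty read keeps the count at exactly [m]. *)
  have st := @StepRead W P n M B s 0 0 0 isT isT.
  eexists; split; first by rewrite -addn1; exact: execution_rcons ex st.
    exact: slowE.
  by move=> e lt_e _; rewrite cache_at_read //= readE //; lia.
have len_M : m * B + minn B (n - m * B) <= M by lia.
have st := @StepRead W P n M B s (m * B) (m * B) _ len_B len_M.
eexists; split; first by rewrite -addn1; exact: execution_rcons ex st.
  exact: slowE.
move=> e lt_e lt_mB; rewrite cache_at_read //=.
case: ifP => [le_e | out_e]; first by congr slow; lia.
by rewrite readE //; rewrite mulSn in lt_mB; lia.
Qed.

Lemma init_diagonal s : n <= M ->
  (forall e, e < n -> cache_at s e = Some (Word (Input e.+1) (nth (least P) x e))) ->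
  exists2 s', exec 0 s s' & diagonal_in_cache (final_table P x) s'.
Proof.
move=> le_nM inp.
suff H m : m <= n -> exists s', [/\ exec 0 s s',
    forall e, e < m -> cache_at s' e =
      Some (Word (Partial e.+1 e.+1 [::]) (final_table P x e.+1 e.+1))
    & forall e, m <= e -> cache_at s' e = cache_at s e].
  by have [s' [ex diag _]] := H n (leqnn n); exists s'.
elim: m => [|m IHm] le_m.
  by exists s; split=> //; exact: ExecNil.
have [s' [ex diag same]] := IHm (ltnW le_m).
have m_lt : m < M by lia.
have c_m : cache s' (Ordinal m_lt) = Some (Word (Input m.+1) (nth (least P) x m)).
  by rewrite -cache_at_ord /= same ?inp.
have st := @StepInit W P n M B s' _ (Ordinal m_lt) _ _ c_m.
eexists; split; first exact: execution_rcons ex st.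
  move=> e le_e; rewrite cache_at_set /=; case: eqP => [->|neq_e].
    by have [-> //] := final_tableP P x; lia.
  by apply: diag; lia.
move=> e lt_e; rewrite cache_at_set /=; case: eqP => [|_]; first by lia.
by apply: same; lia.
Qed.

(** Since [n < (n %/ B).+1 * B], that many reads load the input; the other I/O is the final
    write. *)
Lemma Astar_execution_few_reads : 0 < n -> 0 < B -> 2 * n <= M ->
  Astar_execution P M B x (n %/ B).+2.
Proof.
move=> n_gt0 B_gt0 le_M.
have le_nM : n <= M by lia.
have [s1 [ex1 slow1 read1]] := read_input (n %/ B).+1 le_nM.
have inp1 e : e < n -> cache_at s1 e = Some (Word (Input e.+1) (nth (least P) x e)).
  move=> lt_e; rewrite read1 ?slow1 ?slow_initial //.
  by apply: ltn_trans lt_e _; rewrite ltn_ceil.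
have [s2 ex2 diag2] := init_diagonal le_nM inp1.
have ws : n + workspace 1 n <= M by rewrite /workspace; case: eqP; lia.
have [_ T_rec] := final_tableP P x.
have [s3 [p [ex3 lt_p [K cK at_p] _]]] :=
  compute_final T_rec (leqnn (n - 1)) n_gt0 (leqnn n) (leqnn n) ws diag2.
have p_M : p + 1 <= M by lia.
(* The result replaces the first input word in slow memory. *)
have st4 := @StepWrite W P n M B s3 p 0 1 B_gt0 p_M.
have ex4 := execution_rcons (execution_trans (execution_trans ex1 ex2) ex3) st4.
rewrite !addn0 addn1 in ex4.
eexists; first exact: ex4.
by exists 0, K; split; rewrite //= addn0; exact: at_p.
Qed.

End Execution.

(** The bound is multiplied through by [B]; the maximum covers [n < B], where the constant number of
    I/Os dominates. *)
Theorem theorem7 :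
  exists c : nat,
    forall (n M B : nat) (W : Type) (P : dp_ops W) (x : n.-tuple W),
      0 < n -> 0 < B -> 2 * n <= M ->
      exists q : nat, Astar_execution P M B x q /\ q * B <= c * maxn n B.
Proof.
(* The constant comes from [(n %/ B + 2) * B <= n + 2 * B]. *)
exists 3 => n M B W P x n_gt0 B_gt0 le_M.
exists (n %/ B).+2; split; first exact: Astar_execution_few_reads.
by have := leq_divM n B; rewrite !mulSn; lia.
Qed.
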